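(* For pairs $\mathcal S=(\gamma_1,\gamma_2)$ of weighted density operators on a finite-dimensional complex Hilbert space $\mathscr H$, define the (non-linear) mappings $\tau_{\nparallel}$ and $\tau_{\mathrm{skew}}$ by $$\tau_{\nparallel}[\mathcal S]=(\Pi_{\nparallel}\gamma_1\Pi_{\nparallel},\Pi_{\nparallel}\gamma_2\Pi_{\nparallel}),\qquad \tau_{\mathrm{skew}}[\mathcal S]=(\Pi_{\mathrm{skew}}\gamma_1\Pi_{\mathrm{skew}},\Pi_{\mathrm{skew}}\gamma_2\Pi_{\mathrm{skew}}),$$ where (depending on $\mathcal S$) $\Pi_{\nparallel}$ is the orthogonal projector onto $\ker\gamma_1+\ker\gamma_2$ and $\Pi_{\mathrm{skew}}$ is the orthogonal projector onto $(\ker\gamma_1+\operatorname{supp}\gamma_2)\cap(\ker\gamma_2+\operatorname{supp}\gamma_1)$. Then $\tau_{\nparallel}\circ\tau_{\nparallel}=\tau_{\nparallel}$, $\tau_{\mathrm{skew}}\circ\tau_{\mathrm{skew}}=\tau_{\mathrm{skew}}$, and $\tau_{\mathrm{skew}}\circ\tau_{\nparallel}=\tau_{\nparallel}\circ\tau_{\mathrm{skew}}$.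
   Context: A weighted density operator is a positive semi-definite operator on $\mathscr H$ (no normalization of the trace is required). For a positive semi-definite operator $\rho$, $\operatorname{supp}\rho=(\ker\rho)^\perp$. *)

(* Defs.v *)
From HB Require Import structures.
From mathcomp Require Import all_boot all_order all_algebra.
From mathcomp Require Import reals.
From mathcomp Require Import complex.

Set Implicit Arguments.
Unset Strict Implicit.
Unset Printing Implicit Defensive.

Import Order.TTheory GRing.Theory Num.Theory Num.Def.
Local Open Scope ring_scope.

(* A finite-dimensional complex Hilbert space is an H : vectType R[i], with     *)
(* R : realType, together with an inner product dot : {dot H for conjC}, linear *)
(* in its first argument. The zero space is allowed. Operators multiply by \o   *)
(* in %VF, since 'End(H) is a ring only when H is nontrivial.                   *)

Section Hilbert.
Variables (R : realType) (H : vectType R[i]) (dot : {dot H for conjC}).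
Implicit Types (V : {vspace H}) (u v : H).

Definition oproj V : 'End(H) := daddv_pi V (orthov dot V).

Lemma capv_orthov V : (V :&: orthov dot V = 0)%VS.
Proof.
apply/eqP; rewrite -subv0; apply/subvP => v; rewrite memv_cap memv0.
case/andP=> Vv /mem_orthovP /(_ v Vv) vv0.
by rewrite -(dnorm_eq0 dot) vv0.
Qed.

Lemma addv_orthov V : (V + orthov dot V = fullv)%VS.
Proof.
have dimI (s : seq 'Hom(H, R[i]^o)) :
    (\dim {:H} <= \dim (\bigcap_(f <- s) lker f) + size s)%N.
  elim: s => [|f s IHs]; first by rewrite big_nil addn0.
  rewrite big_cons /= addnS -addSn; apply: leq_trans IHs _; rewrite leq_add2r.
  set W := (\bigcap_(j <- s) _)%VS; rewrite -(limg_ker_dim f W) capvC.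
  rewrite -addn1 leq_add2l; apply: leq_trans (dimvS (subvf _)) _.
  by rewrite dimvf.
apply/eqP; rewrite eqEdim subvf dimv_disjoint_sum ?capv_orthov //.
rewrite addnC; set F := fun i : 'I_(\dim V) =>
  (linfun (applyr dot (vbasis V)`_i : H -> R[i]^o)).
have size_ord : size (index_enum 'I_(\dim V)) = \dim V.
  by rewrite [index_enum _]unlock -enumT size_enum_ord.
have := dimI [seq F i | i <- index_enum 'I_(\dim V)].
by rewrite big_map size_map size_ord.
Qed.

Lemma oproj_sub_orthov V u : u - oproj V u \in orthov dot V.
Proof.
rewrite -{1}[u](daddv_pi_add (capv_orthov V)) ?addv_orthov ?memvf //.
by rewrite addrC addKr memv_pi.
Qed.

Lemma oproj_adj V u v : dot (oproj V u) v = dot u (oproj V v).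
Proof.
have dotP x y : dot (oproj V x) (y - oproj V y) = 0.
  apply/eqP; rewrite herm_eq0C; apply/eqP.
  by apply: (mem_orthovP (oproj_sub_orthov V y)); apply: memv_pi.
have -> : dot (oproj V u) v = dot (oproj V u) (oproj V v).
  by have /eqP := dotP u v; rewrite linearBr subr_eq0 => /eqP.
have /mem_orthovP/(_ (oproj V v)) := oproj_sub_orthov V u.
by rewrite memv_pi linearBl => /(_ isT)/eqP; rewrite subr_eq0 eq_sym => /eqP.
Qed.

(* In R[i], 0 <= z means that z is real and nonnegative; as the scalars are     *)
(* complex, this makes gamma self-adjoint.                                      *)
Definition psd (gamma : 'End(H)) : Prop := forall u, 0 <= dot (gamma u) u.

Record weighted_density :=
  WeightedDensity { wd_op :> 'End(H); wd_psd : psd wd_op }.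

Definition ker (gamma : weighted_density) : {vspace H} := lker gamma.
Definition supp (gamma : weighted_density) : {vspace H} :=
  orthov dot (ker gamma).

Lemma compress_psd V (gamma : weighted_density) :
  psd (oproj V \o gamma \o oproj V)%VF.
Proof. by move=> u; rewrite !comp_lfunE oproj_adj; apply: wd_psd. Qed.

Definition compress V (gamma : weighted_density) : weighted_density :=
  WeightedDensity (compress_psd V gamma).

Definition npar_space (S : weighted_density * weighted_density) : {vspace H} :=
  (ker S.1 + ker S.2)%VS.

Definition skew_space (S : weighted_density * weighted_density) : {vspace H} :=
  ((ker S.1 + supp S.2) :&: (ker S.2 + supp S.1))%VS.

Definition tau_npar (S : weighted_density * weighted_density) :
    weighted_density * weighted_density :=
  (compress (npar_space S) S.1, compress (npar_space S) S.2).

Definition tau_skew (S : weighted_density * weighted_density) :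
    weighted_density * weighted_density :=
  (compress (skew_space S) S.1, compress (skew_space S) S.2).

End Hilbert.

Arguments tau_npar {R H} dot S.
Arguments tau_skew {R H} dot S.

(* Main.v *)
(* Write V^o for the orthogonal complement. For psd gamma,                      *)
(* ker (Pi_V gamma Pi_V) = Pi_V^-1 (ker gamma), so if Pi_V preserves ker gamma  *)
(* then compression to V turns ker gamma into V^o + ker gamma and supp gamma    *)
(* into V :&: supp gamma. This applies to both V = npar_space S and             *)
(* V = skew_space S; for the latter because its complement is                   *)
(* (supp S.1 :&: ker S.2) + (supp S.2 :&: ker S.1). Hence after compression by  *)
(* either map its space becomes everything, while the space of the other map is *)
(* unchanged. The two projectors commute as (skew_space S)^o <= npar_space S.   *)

Require Import Defs.
From HB Require Import structures.
From mathcomp Require Import all_boot all_order all_algebra.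
From mathcomp Require Import boolp.
From mathcomp Require Import reals.
From mathcomp Require Import complex.
From mathcomp Require Import ring.

Set Implicit Arguments.
Unset Strict Implicit.
Unset Printing Implicit Defensive.

Import Order.TTheory GRing.Theory Num.Theory Num.Def.
Local Open Scope ring_scope.

(** Both spaces depend on the pair only through its two kernels, so the claim splits in two.
    Positivity is used once, in [mem_ker_compress], to find the kernel of a compression. The rest is
    subspace algebra on two kernels [K] and [L]: [npar_npar] and [skewv_skewv] give idempotence,
    since a compression to the full space is the identity. [npar_skewv] and [skewv_npar] let each
    map keep its space after the other, and [compress_comm] exchanges the two compressions. *)

Section Orthov.
Variables (R : realType) (H : vectType R[i]) (dot : {dot H for conjC}).
Implicit Types (A B K L U V W : {vspace H}) (u v w : H).

Lemma oproj_id V v : v \in V -> oproj dot V v = v.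
Proof. exact: daddv_pi_id (capv_orthov dot V). Qed.

Lemma memv_oproj V u : oproj dot V u \in V.
Proof. exact: memv_pi. Qed.

Lemma orthovS U V : (U <= V)%VS -> (orthov dot V <= orthov dot U)%VS.
Proof.
move=> sUV; apply/subvP => w /mem_orthovP Vw.
by apply/mem_orthovP => v /(subvP sUV)/Vw.
Qed.

Lemma orthovK V : orthov dot (orthov dot V) = V.
Proof.
apply: subv_anti; apply/andP; split; last by rewrite orthov_sym.
apply/subvP => u VVu; have Vw := oproj_sub_orthov dot V u.
suff -> : u = oproj dot V u by apply: memv_oproj.
apply/eqP; rewrite -subr_eq0 -(dnorm_eq0 dot) linearBl /=.
rewrite (mem_orthovP VVu) // sub0r oppr_eq0 herm_eq0C.
by apply/eqP/(mem_orthovP Vw)/memv_oproj.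
Qed.

Lemma orthov_add U V :
  orthov dot (U + V)%VS = (orthov dot U :&: orthov dot V)%VS.
Proof.
apply: subv_anti; rewrite subv_cap !orthovS ?addvSl ?addvSr //=.
by rewrite orthovD capvSl capvSr.
Qed.

Lemma orthov_cap U V :
  orthov dot (U :&: V)%VS = (orthov dot U + orthov dot V)%VS.
Proof. by rewrite -[RHS]orthovK orthov_add !orthovK. Qed.

Lemma oproj_fullv u : oproj dot fullv u = u.
Proof. by rewrite oproj_id ?memvf. Qed.

Lemma oproj_eq0 V u : u \in orthov dot V -> oproj dot V u = 0.
Proof.
move=> Vu; apply/eqP.
rewrite -memv0 -(capv_orthov dot V) memv_cap memv_oproj /=.
by rewrite -[oproj _ _ _](subKr u) rpredB ?oproj_sub_orthov.
Qed.

(** Each projector fixes what the other kills: [orthov dot V] lies in [W] and, dually,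
    [orthov dot W] lies in [V]. *)
Lemma oproj_comm V W u : (orthov dot V <= W)%VS ->
  oproj dot V (oproj dot W u) = oproj dot W (oproj dot V u).
Proof.
have sWV : (orthov dot V <= W)%VS -> (orthov dot W <= V)%VS.
  by rewrite -{2}(orthovK V); apply: orthovS.
move: (oproj dot V) (oproj dot W) (memv_oproj V u) (oproj_sub_orthov dot V u)
  (@oproj_id V) (@oproj_id W) (@oproj_eq0 V) (oproj_sub_orthov dot W).
move=> p q Vpu Vu pid qid p0 Wq sVW.
have -> : q u = (u - p u) + q (p u).
  by rewrite -{1}(qid (u - p u)) ?(subvP sVW) // -linearD subrK.
rewrite linearD /= p0 // add0r pid // -[q (p u)](subKr (p u)) rpredB //.
by rewrite (subvP (sWV sVW)).
Qed.

(** As orthogonal projectors are self-adjoint, this says that those onto [V] and [K] commute. *)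
Definition oproj_stable V (K : {vspace H}) :=
  {in K, forall u, oproj dot V u \in K}.

(** At the kernels of a pair this is convertible to [skew_space]. *)
Definition skewv U V : {vspace H} :=
  ((U + orthov dot V) :&: (V + orthov dot U))%VS.

Lemma skewvC U V : skewv U V = skewv V U.
Proof. exact: capvC. Qed.

Lemma orthov_skewv U V : orthov dot (skewv U V) =
  ((orthov dot U :&: V) + (orthov dot V :&: U))%VS.
Proof. by rewrite orthov_cap !orthov_add !orthovK. Qed.

Lemma sub_oproj_stable V K : (K <= V)%VS -> oproj_stable V K.
Proof. by move=> sKV u Ku; rewrite (oproj_id (subvP sKV _ Ku)). Qed.

Lemma skewv_stable K L : oproj_stable (skewv K L) K.
Proof.
move=> u Ku; have wS := oproj_sub_orthov dot (skewv K L) u.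
(* The removed part of [u] is [a + b] with [b] in [K]; [a] vanishes, being orthogonal to [u], to [b]
   and to the projection of [u]. *)
have := wS; rewrite orthov_skewv => /memv_addP[a Aa [b Bb eqw]].
have [Ka Lb] : a \in orthov dot K /\ b \in K.
  by split; [move: Aa | move: Bb]; rewrite memv_cap => /andP[].
have oaK x : x \in K -> dot x a = 0.
  by move=> Kx; apply/eqP; rewrite herm_eq0C; apply/eqP/(mem_orthovP Ka).
suff a0 : a = 0 by rewrite -[oproj _ _ _](subKr u) eqw a0 add0r rpredB.
have Va : a \in orthov dot (skewv K L).
  by rewrite orthov_skewv (subvP (addvSl _ _)).
apply/eqP; rewrite -(dnorm_eq0 dot).
have -> : dot a a = dot (u - oproj dot (skewv K L) u - b) a.
  by rewrite eqw addrK.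
rewrite !linearBl /= (oaK u) // (oaK b) // sub0r subr0 oppr_eq0 herm_eq0C.
by apply/eqP/(mem_orthovP Va)/memv_oproj.
Qed.

Lemma oproj_preim V K K' : (forall u, (u \in K') = (oproj dot V u \in K)) ->
  oproj_stable V K -> K' = (orthov dot V + K)%VS.
Proof.
move=> defK' stK; apply: subv_anti; rewrite subv_add; apply/and3P; split.
- apply/subvP => u; rewrite defK' => kVu.
  by rewrite -(subrK (oproj dot V u) u) memv_add ?oproj_sub_orthov.
- by apply/subvP => u /oproj_eq0; rewrite defK' => ->; apply: mem0v.
by apply/subvP => u; rewrite defK'; apply: stK.
Qed.

Lemma capv_orthov_add V K : oproj_stable V K ->
  (V :&: (orthov dot V + K) = V :&: K)%VS.
Proof.
move=> stK; apply: subv_anti; rewrite subv_cap capvSl capvS ?addvSr // andbT.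
apply/subvP => u; rewrite memv_cap => /andP[Vu /memv_addP[a Va [b Kb eqab]]].
by rewrite -(oproj_id Vu) eqab linearD /= (oproj_eq0 Va) add0r stK.
Qed.

Lemma orthov_skewv_add V K L : oproj_stable V K -> oproj_stable V L ->
  orthov dot (skewv (orthov dot V + K) (orthov dot V + L)) =
  ((V :&: (orthov dot K :&: L)) + (V :&: (orthov dot L :&: K)))%VS.
Proof.
move=> stK stL; have capE A B : oproj_stable V B ->
    ((V :&: A) :&: (orthov dot V + B) = V :&: (A :&: B))%VS.
  by move=> stB; rewrite (capvC V) -capvA capv_orthov_add // !capvA (capvC A).
by rewrite orthov_skewv !orthov_add !orthovK !capE.
Qed.

Lemma orthov_skewv_sub K L : (orthov dot (skewv K L) <= K + L)%VS.
Proof. by rewrite orthov_skewv addvC addvS ?capvSr. Qed.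

Lemma skewv_npar K L (V := (K + L)%VS) :
  skewv (orthov dot V + K) (orthov dot V + L) = skewv K L.
Proof.
have sK : (K <= V)%VS by apply: addvSl.
have sL : (L <= V)%VS by apply: addvSr.
have capE A B : (B <= V)%VS -> (V :&: (A :&: B) = A :&: B)%VS.
  by move=> sB; apply/capv_idPr/(subv_trans _ sB)/capvSr.
rewrite -[LHS]orthovK orthov_skewv_add; [|exact: sub_oproj_stable..].
by rewrite !capE // -orthov_skewv orthovK.
Qed.

(** Both summands of the complement lie in [orthov dot V], so they meet [V] trivially. *)
Lemma skewv_skewv K L (V := skewv K L) :
  skewv (orthov dot V + K) (orthov dot V + L) = fullv.
Proof.
have stK : oproj_stable V K by apply: skewv_stable.
have stL : oproj_stable V L by rewrite /V skewvC; apply: skewv_stable.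
have cap0 A : (A <= orthov dot V)%VS -> (V :&: A = 0)%VS.
  by move=> sA; apply/eqP; rewrite -subv0 -(capv_orthov dot V) capvS.
rewrite -[LHS]orthovK orthov_skewv_add // !cap0 ?addv0 ?orthov0 //.
  by rewrite orthov_skewv addvSr.
by rewrite orthov_skewv addvSl.
Qed.

Lemma addv_addv U K L : ((U + K) + (U + L) = U + (K + L))%VS.
Proof. by rewrite addvA (addvC (U + K)%VS) addvA addvv -addvA. Qed.

Lemma npar_npar K L (V := (K + L)%VS) :
  ((orthov dot V + K) + (orthov dot V + L) = fullv)%VS.
Proof. by rewrite addv_addv addvC addv_orthov. Qed.

Lemma npar_skewv K L (V := skewv K L) :
  ((orthov dot V + K) + (orthov dot V + L) = K + L)%VS.
Proof. by rewrite addv_addv; apply/addv_idPr/orthov_skewv_sub. Qed.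

End Orthov.

Lemma linear_coef_eq0 (C : numClosedFieldType) (x c : C) :
  (forall s, s \is Num.real -> 0 <= s * x + s ^+ 2 * c) -> x = 0.
Proof.
move=> ge0.
(* Adding the cases [s = 1] and [s = -1] gives [0 <= c], which then makes [x] real. *)
have p1 := ge0 1 (rpred1 _); have m1 := ge0 (-1) (rpredN1 _).
rewrite expr1n !mul1r in p1; rewrite sqrrN expr1n mulN1r mul1r in m1.
have c_ge0 : 0 <= c.
  rewrite -(pmulrn_lge0 _ (ltn0Sn 1)).
  suff -> : c *+ 2 = (x + c) + (- x + c) by apply: addr_ge0.
  by rewrite addrACA subrr add0r mulr2n.
have xR : x \is Num.real.
  by rewrite -(addrK c x) rpredB ?ger0_real.
have c1_gt0 : 0 < c + 1 by rewrite ltr_wpDl.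
have c1N0 : c + 1 != 0 by rewrite gt_eqF.
(* The denominator [c + 1] stays nonzero even for [c = 0]; the expression becomes minus a real
   square. *)
have := ge0 (- (x / (c + 1))).
rewrite rpredN rpred_div ?(gtr0_real c1_gt0) // => /(_ isT).
have -> : - (x / (c + 1)) * x + (- (x / (c + 1))) ^+ 2 * c =
   - (x / (c + 1)) ^+ 2 by field.
rewrite oppr_ge0 => sq_le0; apply/eqP.
have : (x / (c + 1)) ^+ 2 == 0.
  rewrite eq_le sq_le0 real_exprn_even_ge0 //.
  by rewrite rpred_div ?(gtr0_real c1_gt0).
by rewrite sqrf_eq0 mulf_eq0 invr_eq0 (negPf c1N0) orbF.
Qed.

Section Compress.
Variables (R : realType) (H : vectType R[i]) (dot : {dot H for conjC}).
Implicit Types (V W : {vspace H}) (u : H) (gamma : weighted_density dot).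

(* First-order variation of 0 <= dot (g w) w at w = u, in the directions        *)
(* s *: g u and (s * 'i) *: g u with s real.                                    *)
Lemma psd_eq0 (g : 'End(H)) u : psd dot g -> dot (g u) u = 0 -> g u = 0.
Proof.
move=> g_ge0 gu0; set v := g u; set c := dot (g v) v.
have expand t :
    0 <= t^* * dot v v + t * dot (g v) u + t * t^* * c.
  have := g_ge0 (u + t *: v); rewrite !linearD /= !linearZ /=.
  rewrite !linearDl /= gu0 add0r !linearZl_LR /=.
  by rewrite mulrDr mulrA [_^* * t]mulrC addrCA addrA.
have plus : dot v v + dot (g v) u = 0.
  apply: (@linear_coef_eq0 _ _ c) => s sR.
  by have := expand s; rewrite (CrealP sR) -mulrDr expr2.
have minus : 'i * (dot (g v) u - dot v v) = 0.
  apply: (@linear_coef_eq0 _ _ c) => s sR.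
  have := expand (s * 'i); rewrite rmorphM /= (CrealP sR) conjCi.
  rewrite [s * 'i * (s * _)]mulrACA ['i * - 'i]mulrN -!expr2 sqrCi.
  by rewrite opprK mulr1; congr (0 <= _ + _); ring.
move/eqP: minus; rewrite mulf_eq0 (negPf (neq0Ci _)) subr_eq0 => /eqP vg.
by move/eqP: plus; rewrite vg -mulr2n mulrn_eq0 dnorm_eq0 => /eqP.
Qed.

Lemma mem_ker_compress V gamma u :
  (u \in ker (compress V gamma)) = (oproj dot V u \in ker gamma).
Proof.
rewrite !memv_ker /= !comp_lfunE; apply/eqP/eqP => [Vgu0 | ->]; last first.
  by rewrite linear0.
apply: psd_eq0; first exact: wd_psd.
by rewrite -oproj_adj Vgu0 linear0l.
Qed.

Lemma conj_lfun_comm (p q g : 'End(H)) : p \o q =1 q \o p ->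
  (p \o (q \o g \o q) \o p = q \o (p \o g \o p) \o q)%VF.
Proof.
move=> pq; have pqE x : p (q x) = q (p x) := pq x.
by apply/lfunP => u; rewrite !comp_lfunE /= (pqE u) pqE.
Qed.

Lemma weighted_density_eq gamma1 gamma2 :
  wd_op gamma1 = wd_op gamma2 -> gamma1 = gamma2.
Proof.
case: gamma1 gamma2 => [g1 p1] [g2 p2] /= eqg.
by case: _ / eqg p2 => p2; rewrite (Prop_irrelevance p1 p2).
Qed.

Lemma compress_fullv gamma : compress fullv gamma = gamma.
Proof.
apply: weighted_density_eq; apply/lfunP => u.
by rewrite /= !comp_lfunE /= !oproj_fullv.
Qed.

Lemma compress_comm V W gamma : (orthov dot V <= W)%VS ->
  compress V (compress W gamma) = compress W (compress V gamma).
Proof.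
move=> sVW; apply: weighted_density_eq => /=.
by apply: conj_lfun_comm => u; apply: oproj_comm.
Qed.

Lemma ker_compress V gamma : oproj_stable dot V (ker gamma) ->
  ker (compress V gamma) = (orthov dot V + ker gamma)%VS.
Proof. exact: oproj_preim (mem_ker_compress V gamma). Qed.

Implicit Type S : weighted_density dot * weighted_density dot.

Lemma ker_compress_npar S (V := npar_space S) :
  ker (compress V S.1) = (orthov dot V + ker S.1)%VS /\
  ker (compress V S.2) = (orthov dot V + ker S.2)%VS.
Proof.
split; apply/ker_compress/sub_oproj_stable; [exact: addvSl | exact: addvSr].
Qed.

Lemma ker_compress_skew S (V := skew_space S) :
  ker (compress V S.1) = (orthov dot V + ker S.1)%VS /\
  ker (compress V S.2) = (orthov dot V + ker S.2)%VS.
Proof.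
split; apply: ker_compress; first exact: skewv_stable.
have -> : V = skewv dot (ker S.2) (ker S.1) by apply: capvC.
exact: skewv_stable.
Qed.

Lemma npar_tau_npar S : npar_space (tau_npar dot S) = fullv.
Proof.
have [e1 e2] := ker_compress_npar S.
exact: etrans (congr2 addv e1 e2) (npar_npar _ _ _).
Qed.

Lemma skew_tau_skew S : skew_space (tau_skew dot S) = fullv.
Proof.
have [e1 e2] := ker_compress_skew S.
exact: etrans (congr2 (skewv dot) e1 e2) (skewv_skewv _ _ _).
Qed.

Lemma npar_tau_skew S : npar_space (tau_skew dot S) = npar_space S.
Proof.
have [e1 e2] := ker_compress_skew S.
exact: etrans (congr2 addv e1 e2) (npar_skewv _ _ _).
Qed.

Lemma skew_tau_npar S : skew_space (tau_npar dot S) = skew_space S.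
Proof.
have [e1 e2] := ker_compress_npar S.
exact: etrans (congr2 (skewv dot) e1 e2) (skewv_npar _ _ _).
Qed.

End Compress.

Theorem lemma7 (R : realType) (H : vectType R[i]) (dot : {dot H for conjC}) :
  [/\ tau_npar dot \o tau_npar dot = tau_npar dot,
      tau_skew dot \o tau_skew dot = tau_skew dot
    & tau_skew dot \o tau_npar dot = tau_npar dot \o tau_skew dot].
Proof.
split; apply: funext => S /=.
- by rewrite {1}/tau_npar npar_tau_npar !compress_fullv.
- by rewrite {1}/tau_skew skew_tau_skew !compress_fullv.
(* Naming the space as an argument lets it be replaced while the pair being compressed stays
   fixed. *)
pose cmp V T := (compress V T.1, compress V T.2) :
  weighted_density dot * weighted_density dot.
apply: etrans (congr1 (cmp^~ (tau_npar dot S)) (skew_tau_npar S)) _.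
apply: etrans _ (congr1 (cmp^~ (tau_skew dot S)) (esym (npar_tau_skew S))).
by congr (_, _); apply: compress_comm; apply: orthov_skewv_sub.
Qed.
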